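(* Let $N_{\max}$ be a finite positive integer, let $N$ be a random variable with values in $\{1,\dots,N_{\max}\}$ and distribution $\gamma_k=\mathrm{P}(N=k)$, $k=1,\dots,N_{\max}$, and let $Y_1,Y_2,\dots$ be integrable independent real random variables, independent of $N$, with $\mathrm{P}(Y_t=0)=0$ for all $t$. Let $p_1\le\cdots\le p_{N_{\max}}$ be real numbers. Put $c_t:=\sum_{k=t}^{N_{\max}}\gamma_k$, $1\le t\le N_{\max}$. Consider Problem (AP2) with data $(N,\{Y_t\},\{p_j\})$ and Problem (AP1) with fixed horizon $n=N_{\max}$, the same values $p_1,\dots,p_{N_{\max}}$, and independent job sizes $c_tY_t=Y_t\sum_{k=t}^{N_{\max}}\gamma_k$, $t=1,\dots,N_{\max}$ (both problems are defined in the context). Then: (1) The optimal value in Problem (AP2) coincides with the optimal value in this Problem (AP1). (2) The optimal policy in Problem (AP2) follows the optimal policy of this Problem (AP1) until the first zero value of $\bar Y_t$ is observed, which indicates termination of the assignment process. That is, if $\pi^*$ is an optimal policy for this Problem (AP1), with $\pi^*_t=g_t(c_1Y_1,\dots,c_tY_t)$ for measurable functions $g_t$, then a policy $\pi\in\Pi(\bar{\mathscr Y})$ that satisfies $\pi_t=g_t(c_1\bar Y_1,\dots,c_t\bar Y_t)$ for every $t$ preceding the first time at which a zero value of $\bar Y$ is observed is optimal in Problem (AP2).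
   Context: Policies. For a filtration $\mathscr G=\{\mathscr G_t,1\le t\le n\}$, $\Pi(\mathscr G)$ denotes the set of all policies, i.e. random permutations $\pi=(\pi_1,\dots,\pi_n)$ of $\{1,\dots,n\}$ such that $\{\pi_t=j\}\in\mathscr G_t$ for all $1\le j\le n$, $1\le t\le n$. Problem (AP1) (sequential assignment, fixed horizon $n$). Given real numbers $p_1\le\cdots\le p_n$ and independent integrable job sizes $W_1,\dots,W_n$ with natural filtration $\mathscr W_t=\sigma(W_1,\dots,W_t)$, maximize $S_n(\pi)=\mathrm{E}\sum_{t=1}^n p_{\pi_t}W_t$ over $\pi\in\Pi(\mathscr W)$. The optimal value is $\sup_{\pi\in\Pi(\mathscr W)}S_n(\pi)$; a policy attaining it is called optimal. Problem (AP2) (sequential assignment, random horizon $N$). With $N$, $\{Y_t\}$, $p_1\le\cdots\le p_{N_{\max}}$ as in the claim, define for $t=1,\dots,N_{\max}$: $\bar Y_t=Y_t$ if $t\le N$ and $\bar Y_t=0$ if $t>N$. Let $\bar{\mathscr Y}_t=\sigma(\bar Y_1,\dots,\bar Y_t)$ and $\bar{\mathscr Y}=\{\bar{\mathscr Y}_t,1\le t\le N_{\max}\}$. Maximize $S_\gamma(\pi)=\mathrm{E}\sum_{t=1}^{N}p_{\pi_t}Y_t$ over $\pi\in\Pi(\bar{\mathscr Y})$. The optimal value is $\sup_{\pi\in\Pi(\bar{\mathscr Y})}S_\gamma(\pi)$; a policy attaining it is called optimal. *)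

(* Defs.v *)
From mathcomp Require Import all_boot all_order all_algebra all_fingroup finmap.
From mathcomp Require Import all_classical all_reals all_analysis.

Set Implicit Arguments.
Unset Strict Implicit.
Unset Printing Implicit Defensive.

Import Order.TTheory GRing.Theory Num.Theory.
Import numFieldNormedType.Exports.

Local Open Scope classical_set_scope.
Local Open Scope ring_scope.

(* All periods and job labels are shifted by one: the index [t : 'I_n] (or
   [t : nat]) stands for period t + 1.  The horizon N is not shifted, so
   "period t is played", i.e. t + 1 <= N in the usual numbering, reads
   [(t < N w)%N]. *)

Section Independence.
Context d (T : measurableType d) (R : realType) (P : probability T R).
Implicit Types Y : nat -> T -> R.

Definition independent_seq Y : Prop :=
  forall (J : {fset nat}) (B : nat -> set R),
    (forall j, measurable (B j)) ->
    P (\bigcap_(j in [set` J]) (Y j @^-1` B j))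
    = (\prod_(j <- J) P (Y j @^-1` B j))%E.

Definition independent_sigma (F G : set (set T)) : Prop :=
  forall A B, F A -> G B -> P (A `&` B) = (P A * P B)%E.

Definition sigma_seq Y : set (set T) :=
  <<s \bigcup_j preimage_set_system setT (Y j) measurable >>.

Definition sequence_independent_of Y (N : T -> nat) : Prop :=
  independent_sigma (sigma_seq Y) (preimage_set_system setT N measurable).

End Independence.

Section Policies.
Context d (T : measurableType d) (R : realType) (n : nat).

(* The observations made in the periods up to and including [t]. *)
Definition history (X : 'I_n -> T -> R) (t : 'I_n) (s : 'I_t.+1) : T -> R :=
  X (widen_ord (ltn_ord t) s).

Definition natural_filtration (X : 'I_n -> T -> R) (t : 'I_n) : set (set T) :=
  g_sigma_preimage (history X (t := t)).

Definition policies (G : 'I_n -> set (set T)) : set (T -> {perm 'I_n}) :=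
  [set pi | forall t j : 'I_n, G t [set w | pi w t = j]].

Definition optimal_value (G : 'I_n -> set (set T))
    (S : (T -> {perm 'I_n}) -> \bar R) : \bar R :=
  ereal_sup (S @` policies G).

Definition is_optimal (G : 'I_n -> set (set T))
    (S : (T -> {perm 'I_n}) -> \bar R) (pi : T -> {perm 'I_n}) : Prop :=
  policies G pi /\ S pi = optimal_value G S.

End Policies.

Section Problems.
Context d (T : measurableType d) (R : realType) (P : probability T R) (n : nat).
Variable p : 'I_n -> R.
Implicit Types (W : 'I_n -> T -> R) (Y : nat -> T -> R) (N : T -> nat)
  (pi : T -> {perm 'I_n}).

Definition AP1_reward W pi : \bar R :=
  'E_P[fun w => \sum_(t < n) p (pi w t) * W t w].

Definition AP1_value W : \bar R :=
  optimal_value (natural_filtration W) (AP1_reward W).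

Definition AP1_optimal W pi : Prop :=
  is_optimal (natural_filtration W) (AP1_reward W) pi.

Definition censored N Y : 'I_n -> T -> R :=
  fun t w => if (t < N w)%N then Y t w else 0.

Definition AP2_reward N Y pi : \bar R :=
  'E_P[fun w => \sum_(t < n | (t < N w)%N) p (pi w t) * Y t w].

Definition AP2_value N Y : \bar R :=
  optimal_value (natural_filtration (censored N Y)) (AP2_reward N Y).

Definition AP2_optimal N Y pi : Prop :=
  is_optimal (natural_filtration (censored N Y)) (AP2_reward N Y) pi.

End Problems.

Arguments censored {d T R} n N Y.

Section Reduction.
Context d (T : measurableType d) (R : realType) (n : nat).

(* The shifted index [t] turns the sum over t <= k <= n into t < k <= n. *)
Definition tail_sum (gamma : nat -> R) (t : nat) : R :=
  \sum_(t.+1 <= k < n.+1) gamma k.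

Definition scaled (c : nat -> R) (X : 'I_n -> T -> R) : 'I_n -> T -> R :=
  fun t w => c t * X t w.

(* Decision rules [g t] fed with the first [t + 1] observations of [X]. *)
Definition decision (g : forall t : 'I_n, t.+1.-tuple R -> 'I_n)
    (X : 'I_n -> T -> R) (t : 'I_n) (w : T) : 'I_n :=
  g t [tuple history X s w | s < t.+1].

Definition before_first_zero (X : 'I_n -> T -> R) (t : 'I_n) (w : T) : Prop :=
  forall s : 'I_n, (s <= t)%N -> X s w != 0.

End Reduction.

Arguments tail_sum {R} n gamma t.

(* Main.v *)
Require Import Defs.
From mathcomp Require Import all_boot all_order all_algebra all_fingroup finmap.
From mathcomp Require Import all_classical all_reals all_analysis.
From mathcomp Require Import measurable_realfun.

Set Implicit Arguments.
Unset Strict Implicit.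
Unset Printing Implicit Defensive.

Import Order.TTheory GRing.Theory Num.Theory.
Import numFieldNormedType.Exports.

Local Open Scope classical_set_scope.
Local Open Scope ring_scope.

(* The events {t < N} depend on N only, so they are independent of sigma(Y), and
   P(t < N) = c_t (times start at 0).  If pi is a policy for the scaled sizes
   c_t Y_t and pi' a policy for the censored sizes such that pi'_t = pi_t almost
   surely on {t < N} for every t, then
     E sum_{t < N} p_{pi'_t} Y_t = sum_t P(t < N) E[p_{pi_t} Y_t],
   which is the reward of pi in (AP1).  Every policy on either side has such a
   partner on the other: on {t < N} the two observation sequences up to time t
   are obtained from each other by rescaling (periods with c_t = 0 are almost
   surely never played).  The rescaled decisions may clash off {t < N}; they
   are made into a permutation by a causal greedy repair. *)

(** * Greedy choice without repetition in a finite type *)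

Section Greedy.
Variable I : finType.
Implicit Types (x : I) (u : seq I) (f : nat -> I).

(** The replacement depends on [u] and [x] alone, which keeps the repair causal. The default [x] is
    reached only when [u] exhausts [I]. *)
Definition fresh u x : I :=
  if x \notin u then x else odflt x [pick y | y \notin u].

Fixpoint greedy f (k : nat) : seq I :=
  if k is m.+1 then rcons (greedy f m) (fresh (greedy f m) (f m)) else [::].

Lemma fresh_notin u x : (size u < #|I|)%N -> fresh u x \notin u.
Proof.
move=> ltu; rewrite /fresh; case: ifPn => // _.
case: pickP => [//|/= all_in].
suff : (#|I| <= size u)%N by rewrite leqNgt ltu.
rewrite (leq_trans _ (card_size u))//; 
apply/subset_leq_card/fintype.subsetP => y _.
by have := all_in y; rewrite /= => /negbFE.
Qed.

Lemma size_greedy f k : size (greedy f k) = k.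
Proof. by elim: k => //= k IHk; rewrite size_rcons IHk. Qed.

Lemma eq_greedy f g k :
  (forall i, (i < k)%N -> f i = g i) -> greedy f k = greedy g k.
Proof.
elim: k => //= k IHk fg; rewrite fg// IHk// => i ik.
by rewrite fg// ltnW.
Qed.

Lemma mem_greedy f m k :
  (m < k)%N -> fresh (greedy f m) (f m) \in greedy f k.
Proof.
elim: k => // k IHk; rewrite ltnS leq_eqVlt => /orP[/eqP->|mk] /=.
  by rewrite mem_rcons inE eqxx.
by rewrite mem_rcons inE IHk// orbT.
Qed.

(** No wish clashes with an earlier one, so [fresh] always keeps it. *)
Lemma greedy_inj f k :
  {in [pred i | i < k]%N &, injective f} -> greedy f k = mkseq f k.
Proof.
elim: k => //= k IHk finj; rewrite mkseqS IHk; last first.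
  by move=> i j ik jk; apply: finj; rewrite inE ltnW.
rewrite /fresh ifT//; apply/mapP => -[i]; rewrite mem_iota add0n => ik.
move=> fki; have ki : k = i by apply: finj; rewrite ?inE// ltnW.
by move: ik; rewrite -ki ltnn.
Qed.

End Greedy.

(** * Causal repair of arbitrary decisions into a permutation *)

Section Repair.
Variables (n : nat) (t0 : 'I_n).
Implicit Types (f g : 'I_n -> 'I_n) (s : {perm 'I_n}).

(** [insubd t0] only extends [f] to all of [nat]: the greedy list of length [t] reads indices below
    [t < n], never the default [t0]. *)
Definition repair_fun f (t : 'I_n) : 'I_n :=
  fresh (greedy (f \o insubd t0) t) (f t).

(** For [i < j] the value at [i] is in the greedy list of length [j], and the value at [j] avoids
    that list, whose length is less than [n]. *)
Lemma repair_fun_inj f : injective (repair_fun f).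
Proof.
have lt_neq (i j : 'I_n) : (i < j)%N -> repair_fun f i <> repair_fun f j.
  move=> ij eij; have := @fresh_notin _ (greedy (f \o insubd t0) j) (f j).
  rewrite size_greedy card_ord => /(_ (ltn_ord j)) /negP; apply.
  rewrite -/(repair_fun f j) -eij.
  by have := mem_greedy (f \o insubd t0) ij; rewrite /= valKd.
move=> i j eij; case: (ltngtP i j) => [/lt_neq//|/lt_neq ji|].
  by rewrite eij in ji.
exact: val_inj.
Qed.

Definition repair f : {perm 'I_n} := perm (@repair_fun_inj f).

(** Causality, from which the repaired decisions inherit adaptedness. *)
Lemma eq_repair f g (t : 'I_n) :
  (forall i : 'I_n, (i <= t)%N -> f i = g i) -> repair f t = repair g t.
Proof.
move=> fg; rewrite !permE /repair_fun fg//; congr (fresh _ _).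
apply: eq_greedy => i it /=; apply: fg.
by rewrite val_insubd (ltn_trans it (ltn_ord t)) ltnW.
Qed.

(** A permutation has no clashes, so the greedy choice leaves its values unchanged up to [t]. *)
Lemma repair_perm f s (t : 'I_n) :
  (forall i : 'I_n, (i <= t)%N -> f i = s i) -> repair f t = s t.
Proof.
move=> /eq_repair ->; rewrite permE /repair_fun greedy_inj; last first.
  move=> i j; rewrite !inE => it jt /perm_inj /(congr1 val).
  by rewrite !val_insubd !(ltn_trans _ (ltn_ord t)).
rewrite /fresh ifT//; apply/mapP => -[i]; rewrite mem_iota add0n => it.
move=> /perm_inj /(congr1 val); rewrite val_insubd (ltn_trans it (ltn_ord t)).
by move=> ti; rewrite -ti ltnn in it.
Qed.

End Repair.

(** There are finitely many maps from [K] to [I], so the event is a finite union, over those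
    satisfying [Q], of finite intersections. *)
Lemma sigma_algebra_finfun (T : pointedType) (F : set (set T)) (K I : finType)
    (f : T -> K -> I) (Q : (K -> I) -> Prop) :
  sigma_algebra setT F -> (forall k i, F [set w | f w k = i]) ->
  F [set w | Q (f w)].
Proof.
move=> sF Ff.
pose G : measurableType _ := g_sigma_algebraType F.
have GE : @measurable _ G = F by exact: sigma_algebra_id.
rewrite -GE (_ : [set _ | _] = \bigcup_(g in [set g : {ffun K -> I} | Q g])
    \bigcap_(k in [set: K]) [set w | f w k = g k]).
  apply: (@fin_bigcup_measurable _ G) => // g _.
  by apply: (@fin_bigcap_measurable _ G) => // k _; rewrite GE.
apply/seteqP; split=> w /= => [Qw|[g Qg fg]].
  have gE : [ffun k => f w k] = f w :> (K -> I).
    by apply/funext => k; rewrite ffunE.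
  by exists [ffun k => f w k] => [|k _] /=; rewrite gE.
by rewrite (_ : f w = g)//; apply/funext => k; exact: fg.
Qed.

(** * Natural filtrations and transfer of policies between them *)

Section Filtration.
Context d (T : measurableType d) (R : realType) (n : nat).
Implicit Types X : 'I_n -> T -> R.

Lemma natural_filtration_sigma_algebra X t :
  sigma_algebra setT (natural_filtration X t).
Proof. exact: smallest_sigma_algebra. Qed.

Lemma natural_filtration_sub X (t : 'I_n) (F : set (set T)) :
  sigma_algebra setT F ->
  (forall (s : 'I_n) B, (s <= t)%N -> measurable B -> F (X s @^-1` B)) ->
  natural_filtration X t `<=` F.
Proof.
move=> sF XF; apply: smallest_sub => //; rewrite -bigcup_seq.
move=> _ [s _ [B mB <-]]; rewrite setTI.
by apply: XF => //=; rewrite -ltnS.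
Qed.

Lemma natural_filtration_preimage X (s t : 'I_n) B : (s <= t)%N ->
  measurable B -> natural_filtration X t (X s @^-1` B).
Proof.
move=> st mB; apply: (@sub_gen_smallest _ (sigma_algebra setT)).
rewrite -bigcup_seq.
exists (Ordinal (st : (s < t.+1)%N)); first by rewrite /= mem_index_enum.
exists B => //; rewrite setTI /history.
by rewrite (_ : widen_ord _ _ = s)//; exact: val_inj.
Qed.

Lemma natural_filtration_mono X (s t : 'I_n) : (s <= t)%N ->
  natural_filtration X s `<=` natural_filtration X t.
Proof.
move=> st; apply: natural_filtration_sub => [|r B rs mB].
  exact: natural_filtration_sigma_algebra.
by apply: natural_filtration_preimage => //; exact: leq_trans rs st.
Qed.

(* A substitute for the Doob-Dynkin lemma: an event read off (X_s)_{s <= t} can be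
   recomputed from X' wherever X_s = a_s X'_s for all s <= t. *)
Lemma natural_filtration_transfer X X' (a : 'I_n -> R) (t : 'I_n) A :
  natural_filtration X t A ->
  exists2 A', natural_filtration X' t A' &
    forall w, (forall s : 'I_n, (s <= t)%N -> X s w = a s * X' s w) ->
      A w <-> A' w.
Proof.
pose F : set (set T) := [set A | exists2 A', natural_filtration X' t A' &
    forall w, (forall s : 'I_n, (s <= t)%N -> X s w = a s * X' s w) ->
      A w <-> A' w].
have [G0 GC GU] := natural_filtration_sigma_algebra X' t.
suff : natural_filtration X t `<=` F by apply.
apply: natural_filtration_sub => [|s B st mB].
  split=> [|{}A [A' GA' AA']|{}A FA]; first by exists set0.
    exists (setT `\` A'); first exact: GC.
    by move=> w /AA' AA'w; split=> -[_ nA]; split=> // /AA'w.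
  have /choice[A' A'P] : forall k, exists A', natural_filtration X' t A' /\
      forall w, (forall s : 'I_n, (s <= t)%N -> X s w = a s * X' s w) ->
      A k w <-> A' w.
    by move=> k; have [A' ? ?] := FA k; exists A'.
  exists (\bigcup_k A' k); first by apply: GU => k; exact: (A'P k).1.
  move=> w Xw; split=> -[k _ Akw]; exists k => //; exact/((A'P k).2 w Xw).
exists (X' s @^-1` ((fun x => a s * x) @^-1` B)).
  apply: natural_filtration_preimage => //.
  by rewrite -[X in measurable X]setTI; exact: mulrl_measurable.
by move=> w Xw; rewrite /preimage/= (Xw s st).
Qed.

(** Each event [pi w t = j] is transferred to [X'], a label is read off the transferred events, and
    the labels are repaired. Where [X] is the rescaled [X'] up to [t], the labels are those of [pi]
    and the repair changes nothing. *)
Lemma policy_transfer X X' (a : 'I_n -> R) (pi : T -> {perm 'I_n}) :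
  (0 < n)%N -> policies (natural_filtration X) pi ->
  exists2 pi', policies (natural_filtration X') pi' &
    forall (t : 'I_n) w,
      (forall s : 'I_n, (s <= t)%N -> X s w = a s * X' s w) ->
      pi' w t = pi w t.
Proof.
move=> n_gt0 piX.
have /choice[A AP] : forall tj : 'I_n * 'I_n, exists A',
    natural_filtration X' tj.1 A' /\ forall w,
      (forall s : 'I_n, (s <= tj.1)%N -> X s w = a s * X' s w) ->
      pi w tj.1 = tj.2 <-> A' w.
  move=> [t j] /=.
  by have [A' ? ?] := natural_filtration_transfer X' a (piX t j); exists A'.
pose t0 := Ordinal n_gt0.
(* Off the rescaling event the sets [A (t, j)] may overlap or miss [w]; [pick] and the default [t0]
   still give a label. *)
pose wish w (t : 'I_n) := odflt t0 [pick j | w \in A (t, j)].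
exists (fun w => repair t0 (wish w)); last first.
  move=> t w Xw; apply: repair_perm => s st; rewrite /wish.
  have Asw j : A (s, j) w <-> pi w s = j.
    apply: iff_sym; apply: (AP (s, j)).2 => r rs.
    by apply: Xw; exact: leq_trans rs st.
  case: pickP => [j|/(_ (pi w s))] /=; first by rewrite inE => /Asw.
  by move=> /negP[]; rewrite inE; exact/Asw.
move=> t j.
have sF := natural_filtration_sigma_algebra X' t.
have [F0 FC _] := sF.
have mwish (s i : 'I_n) : (s <= t)%N ->
    natural_filtration X' t [set w | wish w s = i].
  move=> st.
  have FA k : natural_filtration X' t (A (s, k)).
    exact: (natural_filtration_mono st (AP (s, k)).1).
  apply: (@sigma_algebra_finfun T _ 'I_n bool (fun w k => w \in A (s, k))
    (fun b => odflt t0 [pick k | b k] = i) sF) => k [].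
    rewrite (_ : [set _ | _] = A (s, k))//.
    by apply/seteqP; split=> w; [exact: set_mem|exact: mem_set].
  rewrite (_ : [set _ | _] = setT `\` A (s, k)); first exact: FC.
  apply/seteqP; split=> w /=; first by move=> /negbT; rewrite notin_setE.
  by move=> [_ ?]; apply/negbTE; rewrite notin_setE.
(* Wishes after [t] are not yet known at time [t]; by causality they can be replaced by a
   constant. *)
pose early w (s : 'I_n) := if (s <= t)%N then wish w s else t0.
have -> : [set w | repair t0 (wish w) t = j] =
    [set w | repair t0 (early w) t = j].
  have earlyE w : repair t0 (wish w) t = repair t0 (early w) t.
    by apply: eq_repair => s st; rewrite /early st.
  by apply/seteqP; split=> w /= <-; rewrite earlyE.
apply: (@sigma_algebra_finfun T _ 'I_n 'I_n early
  (fun f => repair t0 f t = j) sF) => s i.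
rewrite /early; case: (leqP s t) => [/mwish//|_].
have [->|/eqP t0i] := eqVneq t0 i.
  rewrite (_ : [set _ | _] = setT `\` set0); first exact: FC.
  by rewrite setD0; apply/seteqP; split.
by rewrite (_ : [set _ | _] = set0)//; apply/seteqP; split.
Qed.

End Filtration.

(** * Integration over an event independent of the integrand *)

Section IndependentEvent.
Context d (T : measurableType d) (R : realType) (P : probability T R).
Variables (Z : T -> R) (D : set T).
Hypotheses (mZ : measurable_fun setT Z) (mD : measurable D).
Hypothesis ZD : forall B, measurable B ->
  P (Z @^-1` B `&` D) = (P (Z @^-1` B) * P D)%E.
Local Open Scope ereal_scope.

Lemma ge0_integral_independent_event (f : R -> \bar R) :
  measurable_fun setT f -> (forall x, 0 <= f x) -> f 0%R = 0 ->
  \int[P]_(w in D) f (Z w) = P D * \int[P]_w f (Z w).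
Proof.
move=> mf f0 f00.
(* Off 0 the law of Z 1_D is P(D) times that of Z, and 0 does not contribute
   since f 0 = 0. *)
pose ZI w : R := (Z w * \1_D w)%R.
have mZI : measurable_fun setT ZI.
  by apply: measurable_funM => //; exact: measurable_indic.
have fr : f \_ (~` [set 0%R]) = f.
  apply/funext => x; rewrite patchE; case: ifPn => //.
  by rewrite notin_setE /= => /contrapT ->.
have PD0 : (0 <= fine (P D))%R by rewrite fine_ge0.
pose c : {nonneg R} := NngNum PD0.
have PDc : P D = c%:num%:E by rewrite /= fineK// fin_num_measure.
rewrite integral_mkcond.
transitivity (\int[P]_w (f \o ZI) w).
  apply: eq_integral => w _; rewrite patchE /ZI /= indicE.
  by case: ifPn => wD; rewrite ?mulr1 ?mulr0.
have -> : \int[P]_w (f \o ZI) w = \int[pushforward P ZI]_x f x.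
  by rewrite ge0_integral_pushforward.
have -> : \int[P]_w f (Z w) = \int[pushforward P Z]_x f x.
  by rewrite ge0_integral_pushforward.
rewrite -[in LHS]fr -integral_mkcond -[in RHS]fr -integral_mkcond PDc.
have m0 : measurable (~` [set 0%R : R]) by exact: measurableC.
rewrite -(@ge0_integral_mscale _ _ _ (pushforward P Z) _ m0 c)//; last first.
  exact: measurable_funTS.
apply: eq_measure_integral => A mA A0.
transitivity (P (Z @^-1` A) * P D); last by rewrite PDc muleC.
rewrite -ZD//; congr (P _).
apply/seteqP; split=> w /=; rewrite /ZI indicE.
  have [wD|wD] := boolP (w \in D).
    by rewrite mulr1 => ?; split => //; exact: set_mem.
  by rewrite mulr0 => /A0 /(_ erefl).
by move=> [Aw Dw]; rewrite mem_set// mulr1.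
Qed.

(** The positive and negative parts of the identity are nonnegative and vanish at 0, so the previous
    lemma applies to both. *)
Lemma integral_independent_event : P.-integrable setT (EFin \o Z) ->
  \int[P]_(w in D) (Z w)%:E = P D * \int[P]_w (Z w)%:E.
Proof.
move=> iZ.
rewrite [in LHS]integralE [in RHS]integralE.
rewrite muleBr ?fin_num_measure//; last exact: integrable_add_def.
have mEFin : measurable_fun setT (@EFin R) by exact/measurable_EFinP.
have fp : (fun w => (Z w)%:E)^\+ = (fun w => EFin^\+ (Z w)) by rewrite unlock.
have fn : (fun w => (Z w)%:E)^\- = (fun w => EFin^\- (Z w)) by rewrite unlock.
rewrite fp fn; congr (_ - _).
  apply: (ge0_integral_independent_event (f := EFin^\+)) => //.
    exact: measurable_funepos.
  by rewrite unlock maxxx.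
apply: (ge0_integral_independent_event (f := EFin^\-)) => //.
  exact: measurable_funeneg.
by rewrite unlock oppe0 maxxx.
Qed.

End IndependentEvent.

(** * The probability that a period is played *)

Section TailSum.
Context d (T : measurableType d) (R : realType) (P : probability T R).
Variables (n : nat) (N : {RV P >-> nat}) (gamma : nat -> R).
Hypothesis N_range : forall w, (1 <= N w <= n)%N.
Hypothesis N_distr : forall k : nat, (1 <= k <= n)%N ->
  P [set w | N w = k] = (gamma k)%:E.

(** As [N <= n], the event is the disjoint union of the events [N = k] for [t < k <= n]. *)
Lemma probability_alive t : P [set w | (t < N w)%N] = (tail_sum n gamma t)%:E.
Proof.
rewrite (_ : [set _ | _] =
    \bigcup_(k in [set` index_iota t.+1 n.+1]) [set w | N w = k]).
  rewrite measure_fin_bigcup//.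
  - rewrite -fsbig_seq ?iota_uniq// /tail_sum -sumEFin big_seq [in RHS]big_seq.
    apply: eq_bigr => k; rewrite mem_index_iota => /andP[tk kn].
    by rewrite /= N_distr// (leq_trans _ tk).
  - exact: finite_seq.
  - by move=> i j _ _ [w [/= <- <-]].
  - move=> k _; rewrite -[X in measurable X]setTI.
    exact: (measurable_funPT N measurableT [set k]).
apply/seteqP; split=> w /=.
  move=> tN; exists (N w) => //=; rewrite mem_index_iota tN ltnS.
  by have /andP[] := N_range w.
by move=> [k /= + ->]; rewrite mem_index_iota => /andP[].
Qed.

End TailSum.

(** * Equal rewards for partner policies *)

Section Coupling.
Context d (T : measurableType d) (R : realType) (P : probability T R).
Variables (n : nat) (N : {RV P >-> nat}) (Y : nat -> {RV P >-> R}).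
Variables (p c : 'I_n -> R).
Hypothesis Y_integrable : forall t, P.-integrable setT (EFin \o Y t).
Hypothesis YN_independent : sequence_independent_of P (fun t => Y t) N.
Hypothesis cE : forall t : 'I_n, P [set w | (t < N w)%N] = (c t)%:E.
Implicit Types pi : T -> {perm 'I_n}.

Let W : 'I_n -> T -> R := fun t w => c t * Y t w.

Lemma measurable_alive t : measurable [set w | (t < N w)%N].
Proof.
rewrite -[X in measurable X]setTI.
exact: (measurable_funPT N measurableT [set k | (t < k)%N]).
Qed.

Lemma sigma_seq_preimage t B :
  measurable B -> sigma_seq (fun t => Y t) (Y t @^-1` B).
Proof.
move=> mB; apply: (@sub_gen_smallest _ (sigma_algebra setT)).
by exists t => //; exists B => //; rewrite setTI.
Qed.

Lemma sigma_seq_measurable : sigma_seq (fun t => Y t) `<=` measurable.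
Proof.
apply: smallest_sub; first exact: sigma_algebra_measurable.
move=> _ [t _ [B mB <-]]; rewrite setTI -[X in measurable X]setTI.
exact: (measurable_funPT (Y t)).
Qed.

(** This makes the decisions of an (AP1) policy independent of [N]. *)
Lemma natural_filtration_scaled_sub t :
  natural_filtration W t `<=` sigma_seq (fun t => Y t).
Proof.
apply: natural_filtration_sub => [|s B st mB].
  exact: smallest_sigma_algebra.
have -> : W s @^-1` B = Y s @^-1` ((fun x => c s * x) @^-1` B) by [].
apply: sigma_seq_preimage.
by rewrite -[X in measurable X]setTI; exact: mulrl_measurable.
Qed.

Lemma natural_filtration_censored_measurable t :
  natural_filtration (censored n N (fun t => Y t)) t `<=` measurable.
Proof.
apply: natural_filtration_sub => [|s B st mB].
  exact: sigma_algebra_measurable.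
rewrite -[X in measurable X]setTI.
have mC : measurable_fun setT (censored n N (fun t => Y t) s).
  apply: measurable_fun_ifT => //.
  apply: (measurable_fun_bool true); rewrite setTI.
  rewrite (_ : _ @^-1` _ = [set w | (s < N w)%N])//; exact: measurable_alive.
exact: mC.
Qed.

Lemma measurable_assigned pi (t : 'I_n) :
  (forall j, measurable [set w | pi w t = j]) ->
  measurable_fun setT (fun w => p (pi w t)).
Proof.
move=> mpi _ B mB; rewrite setTI.
rewrite (_ : _ @^-1` _ =
    \bigcup_(j in [set j | B (p j)]) [set w | pi w t = j]).
  exact: fin_bigcup_measurable.
apply/seteqP; split=> w /=; first by exists (pi w t).
by move=> [j Bj ->].
Qed.

(** The factor [p (pi w t)] is measurable and bounded by the sum of all [|p j|]. *)
Lemma integrable_assigned pi (t : 'I_n) :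
  (forall j, measurable [set w | pi w t = j]) ->
  P.-integrable setT (fun w => (p (pi w t) * Y t w)%:E).
Proof.
move=> mpi.
have := integrableMr measurableT (measurable_assigned mpi) _ (Y_integrable t).
apply; exists (\sum_j `|p j|); split; first by rewrite num_real.
move=> M pM w _; rewrite /= (le_trans _ (ltW pM))//.
by rewrite (bigD1 (pi w t))//= lerDl sumr_ge0.
Qed.

Lemma AP1_reward_sum pi : policies (natural_filtration W) pi ->
  AP1_reward P p W pi =
  (\sum_(t < n) (c t)%:E * \int[P]_w (p (pi w t) * Y t w)%:E)%E.
Proof.
move=> piW.
have ipi (t : 'I_n) : P.-integrable setT (fun w => (p (pi w t) * Y t w)%:E).
  apply: integrable_assigned => j.
  exact: sigma_seq_measurable (natural_filtration_scaled_sub (piW t j)).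
rewrite /AP1_reward unlock.
transitivity (\int[P]_w \sum_(t < n) (c t)%:E * (p (pi w t) * Y t w)%:E)%E.
  apply: eq_integral => w _; rewrite -sumEFin; apply: eq_bigr => t _.
  by rewrite /W mulrCA EFinM.
rewrite (integral_sum measurableT)// => [|t].
  by apply: eq_bigr => t _; rewrite (integralZl measurableT).
exact: (integrableZl measurableT).
Qed.

(** The random range of summation is encoded by restricting the term of period [t] to the event
    [t < N]; linearity then applies. *)
Lemma AP2_reward_sum pi :
  policies (natural_filtration (censored n N (fun t => Y t))) pi ->
  AP2_reward P p N (fun t => Y t) pi =
  (\sum_(t < n) \int[P]_(w in [set w | (t < N w)%N]) (p (pi w t) * Y t w)%:E)%E.
Proof.
move=> piY.
have ipi (t : 'I_n) : P.-integrable setT (fun w => (p (pi w t) * Y t w)%:E).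
  apply: integrable_assigned => j.
  exact: natural_filtration_censored_measurable (piY t j).
rewrite /AP2_reward unlock.
transitivity (\int[P]_w \sum_(t < n)
    ((fun w => (p (pi w t) * Y t w)%:E) \_ [set w | (t < N w)%N]) w)%E.
  apply: eq_integral => w _; rewrite big_mkcond -sumEFin.
  apply: eq_bigr => t _; rewrite patchE; have [tN|tN] := boolP (t < N w)%N.
    by rewrite mem_set.
  by rewrite memNset//=; exact/negP.
rewrite (integral_sum measurableT)// => [|t].
  by apply: eq_bigr => t _; rewrite -integral_mkcond.
apply: (integrable_mkcond _ (measurable_alive t)).1.
by apply: integrableS (ipi t) => //; exact: measurable_alive.
Qed.

(** Split by the label [j] chosen at [t]: on each piece the product is [p j] times [Y t]. *)
Lemma assigned_preimage pi (t : 'I_n) B : policies (natural_filtration W) pi ->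
  measurable B ->
  sigma_seq (fun t => Y t) ((fun w => p (pi w t) * Y t w) @^-1` B).
Proof.
move=> piW mB; pose G : measurableType _ :=
  g_sigma_algebraType (\bigcup_j preimage_set_system setT (Y j) measurable).
rewrite (_ : _ @^-1` _ = \bigcup_(j in [set: 'I_n])
    ([set w | pi w t = j] `&` Y t @^-1` ((fun x => p j * x) @^-1` B))).
  apply: (@fin_bigcup_measurable _ G) => // j _; apply: (@measurableI _ G).
    exact: natural_filtration_scaled_sub (piW t j).
  apply: sigma_seq_preimage.
  by rewrite -[X in measurable X]setTI; exact: mulrl_measurable.
apply/seteqP; split=> w /=; first by exists (pi w t).
by move=> [j _ [<-]].
Qed.

(** Term by term, [pi2] is replaced by [pi1] on [t < N]; only then is the integrand independent of
    that event, whose probability [c t] factors out. *)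
Lemma AP2_reward_eq_AP1_reward pi1 pi2 :
  policies (natural_filtration W) pi1 ->
  policies (natural_filtration (censored n N (fun t => Y t))) pi2 ->
  (forall t : 'I_n, {ae P, forall w, (t < N w)%N -> pi2 w t = pi1 w t}) ->
  AP2_reward P p N (fun t => Y t) pi2 = AP1_reward P p W pi1.
Proof.
move=> pi1W pi2Y pi21; rewrite AP1_reward_sum// AP2_reward_sum//.
apply: eq_bigr => t _.
have i1 : P.-integrable setT (fun w => (p (pi1 w t) * Y t w)%:E).
  apply: integrable_assigned => j.
  exact: sigma_seq_measurable (natural_filtration_scaled_sub (pi1W t j)).
have i2 : P.-integrable setT (fun w => (p (pi2 w t) * Y t w)%:E).
  apply: integrable_assigned => j.
  exact: natural_filtration_censored_measurable (pi2Y t j).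
transitivity (\int[P]_(w in [set w | (t < N w)%N]) (p (pi1 w t) * Y t w)%:E)%E.
  apply: ae_eq_integral.
  - exact: measurable_alive.
  - exact/measurable_funTS/(measurable_int _ i2).
  - exact/measurable_funTS/(measurable_int _ i1).
  - by apply: filterS (pi21 t) => w /= wt tN; rewrite wt.
rewrite -cE integral_independent_event//.
- by apply/measurable_EFinP; exact: measurable_int i1.
- exact: measurable_alive.
- move=> B mB; apply: YN_independent; first exact: assigned_preimage.
  by exists [set k | (t < k)%N] => //; rewrite setTI.
Qed.

End Coupling.

(** * Equality of the optimal values and transfer of the optimal policy *)

Theorem theorem2 (d : measure_display) (T : measurableType d) (R : realType)
    (P : probability T R) (n : nat) (N : {RV P >-> nat}) (gamma : nat -> R)
    (Y : nat -> {RV P >-> R}) (p : 'I_n -> R)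
    (n_gt0 : (0 < n)%N)
    (N_range : forall w, (1 <= N w <= n)%N)
    (N_distr : forall k : nat, (1 <= k <= n)%N ->
       P [set w | N w = k] = (gamma k)%:E)
    (Y_integrable : forall t, P.-integrable setT (EFin \o Y t))
    (Y_independent : independent_seq P (fun t => Y t))
    (YN_independent : sequence_independent_of P (fun t => Y t) N)
    (Y_neq0 : forall t, P [set w | Y t w = 0] = 0%E)
    (p_sorted : forall i j : 'I_n, (i <= j)%N -> p i <= p j) :
  let c := tail_sum n gamma in
  let Ybar := censored n N (fun t => Y t) in
  let W := scaled c (fun (t : 'I_n) => Y t) in
  AP2_value P p N (fun t => Y t) = AP1_value P p W
  /\
  forall (g : forall t : 'I_n, t.+1.-tuple R -> 'I_n)
         (pistar pi : T -> {perm 'I_n}),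
    (forall t j : 'I_n, measurable (g t @^-1` [set j])) ->
    AP1_optimal P p W pistar ->
    (forall (t : 'I_n) (w : T), pistar w t = decision g W t w) ->
    policies (natural_filtration Ybar) pi ->
    (forall (t : 'I_n) (w : T), before_first_zero Ybar t w ->
       pi w t = decision g (scaled c Ybar) t w) ->
    AP2_optimal P p N (fun t => Y t) pi.
Proof.
move=> c Ybar W.
have cE (t : 'I_n) : P [set w | (t < N w)%N] = (c t)%:E.
  exact: probability_alive N_range N_distr t.
have rewardE pi1 pi2 := AP2_reward_eq_AP1_reward (c := fun t => c t) p
  Y_integrable YN_independent cE (pi1 := pi1) (pi2 := pi2).
have YbarE (s t : 'I_n) w : (s <= t)%N -> (t < N w)%N -> Ybar s w = Y s w.
  by move=> st tN; rewrite /Ybar /censored (leq_ltn_trans st tN).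
have valueE : AP2_value P p N (fun t => Y t) = AP1_value P p W.
  (* The two sets of attainable rewards are equal, not only their suprema. *)
  congr ereal_sup; apply/seteqP; split=> _ [pi piG <-].
    (* From (AP2) to (AP1): [Y s] is recovered from [c s * Y s] by division, which is valid when
       [c s] is nonzero. *)
    have [pi' pi'W pi'E] :=
      policy_transfer (X := Ybar) W (fun s => (c s)^-1) n_gt0 piG.
    exists pi' => //; apply/esym/rewardE => // t.
    (* If [c t = 0], period [t] is almost surely not played and any decision will do. *)
    have [ct0|ct0] := eqVneq (c t) 0.
      exists [set w | (t < N w)%N]; split; first exact: measurable_alive.
        by rewrite cE ct0.
      by move=> w /= /not_implyP[].
    apply: aeW => w tN; apply/esym/pi'E => s st; rewrite (YbarE _ _ _ st tN).
    (* For [s <= t] the event [t < N] lies in [s < N], so [c s = 0] would force [c t = 0]. *)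
    rewrite /W /scaled mulKf//; apply: contra_neq ct0 => cs0.
    apply/EFin_inj; rewrite -cE.
    apply: (@subset_measure0 _ _ _ P _ [set w | (s < N w)%N]).
    - exact: measurable_alive.
    - exact: measurable_alive.
    - by move=> v /=; exact: leq_ltn_trans.
    - by rewrite -[RHS](congr1 EFin cs0); exact: cE.
  (* From (AP1) to (AP2) no division occurs, so the policies agree everywhere on [t < N]. *)
  have [pi' pi'W pi'E] :=
    policy_transfer (X := W) Ybar (fun s => c s) n_gt0 piG.
  exists pi' => //; apply: rewardE => // t.
  by apply: aeW => w tN; apply: pi'E => s st; rewrite (YbarE _ _ _ st tN).
split=> // g pistar pi _ [pistarW pistar_opt] pistarE piY piE.
(* As the values coincide, it suffices that [pi] earns the same reward as [pistar]. *)
split=> //; rewrite -/(AP2_value P p N (fun t => Y t)) valueE.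
rewrite -[RHS]pistar_opt; apply: rewardE => // t.
(* Almost surely a zero of [Ybar] can only mean termination, so on [t < N] the hypothesis on [pi]
   covers period [t]. *)
have Yn0 : {ae P, forall w, forall s : nat, Y s w != 0}.
  apply/ae_foralln => s.
  exists [set w | Y s w = 0]; split; [|exact: Y_neq0|].
    rewrite -[X in measurable X]setTI.
    exact: (measurable_funPT (Y s) measurableT [set 0]).
  by move=> w /= /negP; rewrite negbK => /eqP.
apply: filterS Yn0 => w Yw tN.
rewrite piE; last first.
  by move=> s st; rewrite -/(Ybar s w) (YbarE _ _ _ st tN); exact: Yw.
rewrite pistarE.
(* On [t < N] both rules receive the same observations up to [t]. *)
rewrite /decision; congr (g t _); apply: eq_from_tnth => i.
by rewrite !tnth_mktuple /history /W /scaled (YbarE _ t)//= -ltnS.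
Qed.
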